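(* Let $n$, $m$, $t$ be positive integers and let $k = mt$, where each prime divisor of $k$ also divides $t$. If $\mathrm{BH}(n,k)$ is nonempty, then $\mathrm{BH}(mn, t)$ is nonempty.
   Context: For positive integers $n,k$, $\mathrm{BH}(n,k)$ denotes the set of $n\times n$ Butson-Hadamard matrices: $n \times n$ complex matrices $H$ all of whose entries are complex $k^{\text{th}}$ roots of unity and which satisfy $HH^* = nI_n$, where $H^*$ is the conjugate transpose of $H$ and $I_n$ is the $n\times n$ identity matrix. *)

(* Defs.v *)
From mathcomp Require Import all_boot all_order all_algebra.
From mathcomp Require Import spectral.
From mathcomp Require Import complex.
From mathcomp Require Import classical_sets reals.

Set Implicit Arguments.
Unset Strict Implicit.
Unset Printing Implicit Defensive.

Import GRing.Theory Num.Theory.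
Local Open Scope ring_scope.
Local Open Scope sesquilinear_scope.
Local Open Scope classical_set_scope.

(* H ^t* is the conjugate transpose; C is meant to be R[i] with R : realType. *)
Definition BH (C : numClosedFieldType) (n k : nat) : set 'M[C]_n :=
  [set H : 'M[C]_n |
    (forall i j, k.-unity_root (H i j)) /\ H *m H ^t* = n%:R%:M].

Arguments BH : clear implicits.

(* Main.v *)
(** Let [k = m * t] and let [z] be a primitive [k]-th root of unity.  Since the
    primes dividing [k] divide [t], all the [z ^+ (1 + l * t)] are conjugate to
    [z], so [X^m - z^m] divides every rational polynomial that vanishes at [z].
    Hence a matrix [M] with [M^m = z^m] satisfies every rational relation
    between powers of [z], and substituting such an [M], if unitary, for [z] in
    a matrix of [BH(n, k)] preserves the orthogonality of the rows.  For [M] we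
    take the [m x m] cyclic shift with one entry replaced by [z^m]: its powers
    are monomial, with [t]-th roots of unity as nonzero entries.  Multiplying
    each block by a fixed matrix of [BH(m, t)], a tensor product of Fourier
    matrices of prime orders, then fills in the zero entries. *)

Require Import Defs.
From mathcomp Require Import all_boot all_order all_fingroup all_algebra.
From mathcomp Require Import all_solvable all_field complex.
From mathcomp Require Import classical_sets reals.

Set Implicit Arguments.
Unset Strict Implicit.
Unset Printing Implicit Defensive.

Import GRing.Theory Num.Theory.

Local Open Scope complex_scope.
Local Open Scope classical_set_scope.

Section CyclotomicRelations.
Local Open Scope ring_scope.

Lemma closed_prim_root_exists (F : closedFieldType) (n : nat) :
  n%:R != 0 :> F -> exists z : F, n.-primitive_root z.
Proof.
move=> n_neq0; have n_gt0 : (0 < n)%N by case: n n_neq0 => //; rewrite eqxx.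
have [rs] := closed_field_poly_normal ('X^n - 1 : {poly F}).
rewrite (monicP _) ?monicXnsubC // scale1r => Xn1E.
suff /hasP[z _ prim_z] : has n.-primitive_root rs by exists z.
apply: has_prim_root => //.
- by apply/allP => z; rewrite -root_prod_XsubC -Xn1E.
- by rewrite -separable_prod_XsubC -Xn1E separable_Xn_sub_1.
- by rewrite -ltnS -(size_prod_XsubC rs id) -Xn1E size_XnsubC.
Qed.

Lemma map_Cyclotomic (F : fieldType) (n : nat) (z : F) :
  n.-primitive_root z -> map_poly intr 'Phi_n = cyclotomic z n.
Proof.
elim/ltn_ind: n z => n IHn z prim_z; have n_gt0 := prim_order_gt0 prim_z.
have n_divisor : n \in divisors n by rewrite -dvdn_divisors.
pose P := \prod_(d <- rem n (divisors n)) cyclotomic (z ^+ (n %/ d)) d.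
have P_neq0 : P != 0.
  by apply/monic_neq0/monic_prod => d _; apply: cyclotomic_monic.
apply: (mulIf P_neq0); transitivity ('X^n - 1 : {poly F}).
  rewrite -(map_polyXn intr) -(rmorph1 (map_poly intr)) -rmorphB /=.
  rewrite -prod_Cyclotomic // (big_rem n) //= rmorphM rmorph_prod.
  congr (_ * _); apply/esym/eq_big_seq => d.
  rewrite mem_rem_uniq ?divisors_uniq // inE -dvdn_divisors //.
  move=> /andP[d_neq_n d_dvd_n].
  by apply: IHn; rewrite ?dvdn_prim_root // ltn_neqAle d_neq_n dvdn_leq.
by rewrite (prod_cyclotomic prim_z) (big_rem n) //= divnn n_gt0 expr1.
Qed.

Lemma irreducible_Cyclotomic (n : nat) :
  (0 < n)%N -> irreducible_poly (map_poly intr 'Phi_n : {poly rat}).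
Proof.
move=> n_gt0; have [z prim_z] := C_prim_root_exists n_gt0.
have [p [minCpE _] dvdpE] := minCpolyP z.
have -> : map_poly intr 'Phi_n = p.
  apply: (map_poly_inj (@ratr algC)); rewrite -minCpE.
  rewrite (minCpoly_cyclotomic prim_z) -(Cintr_Cyclotomic prim_z).
  by rewrite -map_poly_comp; apply: eq_map_poly => a /=; rewrite ratr_int.
have p_neq0 : p != 0.
  by rewrite -(map_poly_eq0 (@ratr algC)) -minCpE minCpoly_eq0.
split=> [|q size_q /dvdpP[r pE]].
  by rewrite -(size_map_poly (@ratr algC)) -minCpE size_minCpoly.
have := dvdpp p; rewrite -dvdpE {1}pE rmorphM rootM /= !dvdpE => /orP[p_r|p_q].
  have /andP[r_neq0 q_neq0] : (r != 0) && (q != 0).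
    by rewrite -negb_or -mulf_eq0 -pE.
  have := dvdp_leq r_neq0 p_r; rewrite pE size_mul // -subn1 leq_subLR addnC.
  rewrite leq_add2r leq_eqVlt (negPf size_q) ltnS leqn0 size_poly_eq0.
  by rewrite (negPf q_neq0).
by rewrite /eqp p_q pE dvdp_mull.
Qed.

Lemma root_prim_root_dvdp (F : numFieldType) (n : nat) (z : F)
    (q : {poly rat}) :
  n.-primitive_root z ->
  root (map_poly ratr q) z = (map_poly intr 'Phi_n %| q).
Proof.
move=> prim_z; have Phi_irr := irreducible_Cyclotomic (prim_order_gt0 prim_z).
set Phi := map_poly _ _ in Phi_irr *.
have Phi_z : root (map_poly ratr Phi) z.
  rewrite -map_poly_comp (@eq_map_poly _ _ _ intr) => [|a /=].
    by rewrite (map_Cyclotomic prim_z) root_cyclotomic.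
  by rewrite ratr_int.
apply/idP/idP => [q_z|/dvdpP[r ->]]; last by rewrite rmorphM rootM Phi_z orbT.
rewrite -[_ %| _]negbK -irreducible_poly_coprime // -(coprimep_map (@ratr F)).
by apply/negP => /coprimep_root/(_ Phi_z)/negP.
Qed.

Lemma coprime_add1_mul_pnat (m t l : nat) :
  (0 < t)%N -> \pi(t).-nat m -> coprime (1 + l * t) (m * t).
Proof.
move=> t_gt0 m_pi; rewrite coprime_sym (@pnat_coprime \pi(t)) //.
  by rewrite pnatM m_pi pnat_pi.
by rewrite -coprime_pi' // addnC /coprime gcdnMDl gcdn1.
Qed.

(* The roots of [X^m - z^m] are the conjugates [z ^+ (1 + l * t)] of [z]. *)
Lemma dvdp_XnsubC_prim_root (F : numFieldType) (m t : nat) (z : F)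
    (q : {poly rat}) :
  \pi(t).-nat m -> (m * t)%N.-primitive_root z -> root (map_poly ratr q) z ->
  'X^m - (z ^+ m)%:P %| map_poly ratr q.
Proof.
move=> m_pi prim_z q_z; have := prim_order_gt0 prim_z.
rewrite muln_gt0 => /andP[m_gt0 t_gt0].
pose rs := [seq z ^+ (1 + l * t) | l <- iota 0 m].
have rs_uniq : uniq_roots rs.
  rewrite uniq_rootsE map_inj_in_uniq ?iota_uniq // => l l'.
  rewrite !mem_iota !add0n /= => l_ltm l'_ltm /eqP.
  rewrite (eq_prim_root_expr prim_z) eqn_modDl !modn_small ?ltn_pmul2r //.
  by rewrite eqn_pmul2r // => /eqP.
have XnE : 'X^m - (z ^+ m)%:P = \prod_(x <- rs) ('X - x%:P).
  rewrite [LHS](@all_roots_prod_XsubC _ _ rs) //.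
  - by rewrite (monicP _) ?monicXnsubC // scale1r.
  - by rewrite size_XnsubC // size_map size_iota.
  apply/allP => _ /mapP[l _ ->]; rewrite rootE !hornerE subr_eq0.
  rewrite -exprM (eq_prim_root_expr prim_z) mulnDl mul1n mulnAC addnC -mulnA.
  by rewrite modnMDl.
rewrite XnE; apply: uniq_roots_dvdp => //; apply/allP => _ /mapP[l _ ->].
rewrite (@root_prim_root_dvdp _ (m * t)).
  by rewrite -(root_prim_root_dvdp _ prim_z).
by rewrite prim_root_exp_coprime // coprime_add1_mul_pnat.
Qed.

Lemma sum_expr_eq0_alg (F : numFieldType) (A : algType F) (m t : nat) (z : F)
    (a : A) (J : finType) (d : J -> nat) :
  \pi(t).-nat m -> (m * t)%N.-primitive_root z -> a ^+ m = (z ^+ m)%:A ->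
  \sum_j z ^+ d j = 0 -> \sum_j a ^+ d j = 0.
Proof.
move=> m_pi prim_z aX sum_z; pose q : {poly rat} := \sum_j 'X^(d j).
have qE : map_poly ratr q = \sum_j 'X^(d j) :> {poly F}.
  by rewrite rmorph_sum; under eq_bigr do rewrite /= map_polyXn.
have q_z : root (map_poly ratr q) z.
  by rewrite qE rootE horner_sum; under eq_bigr do rewrite hornerXn; apply/eqP.
have /dvdpP[r] := dvdp_XnsubC_prim_root m_pi prim_z q_z.
rewrite qE => /(congr1 (horner_alg a)).
rewrite rmorphM rmorphB rmorph_sum /= rmorphXn /= horner_algX horner_algC aX.
rewrite subrr mulr0.
by under eq_bigr do rewrite rmorphXn /= horner_algX.
Qed.

Lemma divr_expr_unity (R : unitRingType) (k i j : nat) (x : R) :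
  (0 < k)%N -> x ^+ k = 1 -> x ^+ i / x ^+ j = x ^+ (i + k.-1 * j).
Proof.
move=> k_gt0 xk1; have x_unit : x \is a GRing.unit.
  by rewrite -(unitrX_pos _ k_gt0) xk1 unitr1.
apply: (mulIr (unitrX j x_unit)); rewrite divrK ?unitrX //.
by rewrite -exprD -addnA -mulSnr prednK // exprD exprM xk1 expr1n mulr1.
Qed.

Lemma sum_expr_div_eq0_alg (F : numFieldType) (A : unitAlgType F) (m t : nat)
    (z : F) (a : A) (J : finType) (d d' : J -> nat) :
  \pi(t).-nat m -> (m * t)%N.-primitive_root z -> a ^+ m = (z ^+ m)%:A ->
  \sum_j z ^+ d j / z ^+ d' j = 0 -> \sum_j a ^+ d j / a ^+ d' j = 0.
Proof.
move=> m_pi prim_z aX; have k_gt0 := prim_order_gt0 prim_z.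
have zk1 := prim_expr_order prim_z.
have ak1 : a ^+ (m * t) = 1.
  by rewrite exprM aX exprZn expr1n -exprM zk1 scale1r.
move=> sum_z; under eq_bigr do rewrite (divr_expr_unity _ _ k_gt0 ak1).
apply: (sum_expr_eq0_alg m_pi prim_z aX); rewrite -[RHS]sum_z.
by apply: eq_bigr => j _; rewrite (divr_expr_unity _ _ k_gt0 zk1).
Qed.

End CyclotomicRelations.

Section UnitaryMatrices.
Local Open Scope ring_scope.
Local Open Scope sesquilinear_scope.
Variable C : numClosedFieldType.

Lemma norm_prim_root_expr (D : numDomainType) (k : nat) (z : D) (e : nat) :
  k.-primitive_root z -> `|z ^+ e| = 1.
Proof.
move=> prim_z; have k_gt0 := prim_order_gt0 prim_z.
apply/eqP; rewrite -(@pexpr_eq1 _ _ k) // -normrX exprAC.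
by rewrite (prim_expr_order prim_z) expr1n normr1.
Qed.

Lemma conjC_norm1 (z : C) : `|z| = 1 -> z^* = z^-1.
Proof. by move=> z1; rewrite invC_norm z1 expr1n invr1 mul1r. Qed.

Lemma unitarymx_expr (m : nat) (M : 'M[C]_m.+1) (e : nat) :
  M \is unitarymx -> M ^+ e \is unitarymx.
Proof.
move=> M_unitary; elim: e => [|e IHe]; last by rewrite exprS mul_unitarymx.
by apply/unitarymxP; rewrite expr0 trmx1 map_mx1 mulmx1.
Qed.

Lemma perm_mx_unitary (m : nat) (s : 'S_m) :
  (perm_mx s : 'M[C]_m) \is unitarymx.
Proof.
by apply/unitarymxP; rewrite tr_perm_mx map_perm_mx -perm_mxM mulgV perm_mx1.
Qed.

Lemma diag_mx_unitary (m : nat) (v : 'rV[C]_m) :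
  (forall i, `|v 0 i| = 1) -> diag_mx v \is unitarymx.
Proof.
move=> v1; apply/unitarymxP.
rewrite tr_diag_mx map_diag_mx mulmx_diag -diag_const_mx.
by congr diag_mx; apply/rowP => i; rewrite !mxE -normCK v1 expr1n.
Qed.

End UnitaryMatrices.

Section ConstacyclicMatrix.
Local Open Scope ring_scope.
Variables (R : pzSemiRingType) (m : nat).
Implicit Type c : R.

(* The matrix of multiplication by [X] modulo [X^(m+1) - c]. *)
Definition constacyclic_mx c : 'M[R]_m.+1 :=
  diag_mx (\row_i c ^+ (i.+1 %/ m.+1)) *m
  perm_mx (perm (@ordS_inj m.+1)).

Lemma mul_constacyclic_mx c p (A : 'M[R]_(m.+1, p)) i j :
  (constacyclic_mx c *m A) i j = c ^+ (i.+1 %/ m.+1) * A (ordS i) j.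
Proof. by rewrite -mulmxA mul_diag_mx -row_permE !mxE permE. Qed.

Lemma mul_expr_constacyclic_mx c d p (A : 'M[R]_(m.+1, p)) i j :
  (constacyclic_mx c ^+ d *m A) i j =
  c ^+ ((i + d) %/ m.+1) * A (inord ((i + d) %% m.+1)) j.
Proof.
elim: d A => [|d IHd] A.
  by rewrite mul1mx addn0 divn_small // modn_small // mul1r inord_val.
rewrite exprSr -mulmxA IHd mul_constacyclic_mx mulrA -exprD inordK ?ltn_pmod //.
rewrite addnS; congr (_ ^+ _ * A _ _).
  by rewrite {3}(divn_eq (i + d) m.+1) -addnS divnMDl.
by apply: val_inj; rewrite /= !inordK ?ltn_pmod // -addn1 modnDml addn1.
Qed.

Lemma constacyclic_mx_expr c : constacyclic_mx c ^+ m.+1 = c%:M.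
Proof.
apply/matrixP => i j; rewrite -[_ ^+ _]mulmx1 mul_expr_constacyclic_mx.
rewrite divnDr // divnn divn_small // modnDr modn_small // inord_val.
by rewrite !mxE mulr_natr.
Qed.

End ConstacyclicMatrix.

Lemma constacyclic_mx_unitary (C : numClosedFieldType) (m : nat) (c : C) :
  `|c|%R = 1%R -> constacyclic_mx m c \is unitarymx.
Proof.
move=> c1; rewrite mul_unitarymx ?perm_mx_unitary ?diag_mx_unitary // => i.
by rewrite mxE normrX c1 expr1n.
Qed.

Section ButsonHadamard.
Local Open Scope ring_scope.
Local Open Scope sesquilinear_scope.
Variable C : numClosedFieldType.
Implicit Types m n t : nat.

Lemma BH_mxblock_nonempty m n t (F : 'M[C]_m) (U : 'I_n -> 'I_n -> 'M[C]_m) :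
  BH C m t F ->
  (forall i i', \sum_j U i j *m (U i' j) ^t* = (n * (i == i'))%:R%:M) ->
  (forall i j a b, t.-unity_root ((U i j *m F) a b)) ->
  BH C (m * n) t !=set0.
Proof.
move=> [_ F_orth] U_orth UF_root.
have -> : (m * n = \sum_(i < n) m)%N by rewrite sum_nat_const card_ord mulnC.
exists (\mxblock_(i, j) (U i j *m F)); split=> [x y|]; first by rewrite mxE.
have -> : (\mxblock_(i, j) (U i j *m F)) ^t* = \mxblock_(i, j) (U j i *m F) ^t*.
  by apply/matrixP => x y; rewrite !mxE.
rewrite mul_mxblock -mxdiagZ; apply: eq_mxblock => i i'.
transitivity (m%:R *: \sum_j U i j *m (U i' j) ^t*).
  rewrite scaler_sumr; apply: eq_bigr => j _.
  rewrite trmx_mul map_mxM mulmxA -(mulmxA (U i j)) F_orth.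
  by rewrite mul_mx_scalar -scalemxAl.
rewrite U_orth scale_scalar_mx -natrM; case: eqP => _.
  by rewrite conform_mx_id muln1 sum_nat_const card_ord mulnC.
by rewrite !muln0 raddf0.
Qed.

Lemma BH_tensor_nonempty m n t :
  BH C m t !=set0 -> BH C n t !=set0 -> BH C (m * n) t !=set0.
Proof.
move=> [F F_BH] [H [H_root H_orth]].
apply: (BH_mxblock_nonempty (U := fun i j => (H i j)%:M) F_BH) =>
  [i i'|i j a b].
  have /matrixP/(_ i i') := H_orth; rewrite natrM mulr_natr !mxE => <-.
  rewrite raddf_sum; apply: eq_bigr => j _.
  by rewrite tr_scalar_mx map_scalar_mx -scalar_mxM !mxE.
case: F_BH => F_root _; apply/unity_rootP.
by rewrite mul_scalar_mx mxE exprMn !(unity_rootP _) ?mulr1.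
Qed.

Lemma BH_Fourier_nonempty m t : (0 < m)%N -> (m %| t)%N -> BH C m t !=set0.
Proof.
move=> m_gt0 /dvdnP[q ->].
have [|z prim_z] := @closed_prim_root_exists C m.
  by rewrite pnatr_eq0 -lt0n.
have zm1 := prim_expr_order prim_z.
exists (\matrix_(i, j) z ^+ (i * j)); split=> [i j|].
  by apply/unity_rootP; rewrite mxE -exprM mulnA mulnC exprM zm1 expr1n.
have z_norm1 e : `|z ^+ e| = 1 := norm_prim_root_expr e prim_z.
apply/matrixP => i i'; pose w := z ^+ i / z ^+ i'.
have zi'_neq0 : z ^+ i' != 0 by rewrite -normr_eq0 z_norm1 oner_eq0.
transitivity (\sum_(j < m) w ^+ j).
  rewrite mxE; apply: eq_bigr => j _; rewrite !mxE conjC_norm1 ?z_norm1 //.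
  by rewrite exprMn exprVn -!exprM.
rewrite mxE; case: eqVneq => [ii'|i_neq_i'].
  under eq_bigr do rewrite /w ii' divff // expr1n.
  by rewrite sumr_const card_ord.
have w_neq1 : w - 1 != 0.
  rewrite subr_eq0 -(inj_eq (mulIf zi'_neq0)) divfK // mul1r.
  by rewrite (eq_prim_root_expr prim_z) !modn_small.
apply: (mulfI w_neq1); rewrite mulr0 -subrX1 exprMn exprVn -!exprM.
by rewrite !(mulnC _ m) !exprM zm1 !expr1n divr1 subrr.
Qed.

Lemma BH_pnat_nonempty m t : (0 < t)%N -> \pi(t).-nat m -> BH C m t !=set0.
Proof.
move=> t_gt0; elim/ltn_ind: m => m IHm m_pi; have /andP[m_gt0 _] := m_pi.
have [m_le1|m_gt1] := leqP m 1.
  by apply: BH_Fourier_nonempty => //; case: m m_gt0 m_le1 {IHm m_pi} => [|[]].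
have p_pi : pdiv m \in \pi(t) by rewrite (pnatPpi m_pi) // pi_pdiv.
have p_dvd := pdiv_dvd m.
rewrite -(divnK p_dvd); apply: BH_tensor_nonempty.
  apply: IHm; last exact: pnat_div m_pi.
  by rewrite ltn_Pdiv // prime_gt1 // pdiv_prime.
apply: BH_Fourier_nonempty; first exact: pdiv_gt0.
by move: p_pi; rewrite mem_primes => /and3P[].
Qed.

Lemma unitarymx_expr_orthogonal m n p t (z : C) (M : 'M[C]_p.+1)
    (H : 'M[C]_n) (e : 'I_n -> 'I_n -> nat) :
  \pi(t).-nat m -> (m * t)%N.-primitive_root z ->
  M \is unitarymx -> M ^+ m = (z ^+ m)%:M ->
  (forall i j, H i j = z ^+ e i j) -> H *m H ^t* = n%:R%:M ->
  forall i i', \sum_j M ^+ e i j *m (M ^+ e i' j) ^t* = (n * (i == i'))%:R%:M.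
Proof.
move=> m_pi prim_z M_unitary; rewrite -scalemx1 => MX HE H_orth i i'.
have [<-|i_neq_i'] := eqVneq i i'.
  rewrite (eq_bigr (fun=> 1%:M)) => [|j _].
    by rewrite sumr_const card_ord muln1 raddfMn.
  exact/unitarymxP/unitarymx_expr.
have sum_z : \sum_j z ^+ e i j / z ^+ e i' j = 0.
  transitivity ((H *m H ^t*) i i'); last by rewrite H_orth mxE (negPf i_neq_i').
  rewrite mxE; apply: eq_bigr => j _; rewrite !mxE !HE conjC_norm1 //.
  exact: norm_prim_root_expr prim_z.
rewrite muln0 raddf0.
under eq_bigr do rewrite -invmx_unitary ?unitarymx_expr //.
exact: (sum_expr_div_eq0_alg m_pi prim_z MX sum_z).
Qed.

Lemma BH_pnat_descent m n t :
  (0 < t)%N -> \pi(t).-nat m -> BH C n (m * t) !=set0 -> BH C (m * n) t !=set0.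
Proof.
move=> t_gt0 m_pi [H [H_root H_orth]].
have [F F_BH] := BH_pnat_nonempty t_gt0 m_pi.
case: m m_pi => // m m_pi in H_root F F_BH *.
have [|z prim_z] := @closed_prim_root_exists C (m.+1 * t).
  by rewrite pnatr_eq0 -lt0n muln_gt0.
pose e i j : nat := sval (prim_rootP prim_z (unity_rootP (H_root i j))).
have HE i j : H i j = z ^+ e i j by rewrite /e; case: prim_rootP.
pose S := constacyclic_mx m (z ^+ m.+1).
apply: (BH_mxblock_nonempty (U := fun i j => S ^+ e i j) F_BH) => [|i j a b].
  apply: (unitarymx_expr_orthogonal m_pi prim_z) => //.
    exact/constacyclic_mx_unitary/(norm_prim_root_expr _ prim_z).
  exact: constacyclic_mx_expr.
case: F_BH => F_root _; apply/unity_rootP.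
rewrite mul_expr_constacyclic_mx exprMn (unity_rootP (F_root _ _)) mulr1.
by rewrite exprAC -(exprM z) (prim_expr_order prim_z) expr1n.
Qed.

End ButsonHadamard.

Theorem theorem1p2 (R : realType) (n m t k : nat)
    (n_gt0 : (0 < n)%N) (m_gt0 : (0 < m)%N) (t_gt0 : (0 < t)%N)
    (def_k : k = (m * t)%N)
    (prime_k_t : forall p : nat, prime p -> (p %| k)%N -> (p %| t)%N) :
  BH R[i] n k !=set0 -> BH R[i] (m * n)%N t !=set0.
Proof.
rewrite def_k in prime_k_t *; apply: BH_pnat_descent => //.
apply/pnatP => // p p_pr p_dvd_m.
by rewrite mem_primes p_pr t_gt0 prime_k_t // dvdn_mulr.
Qed.
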